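(* Let $q$ be a prime power, let $\alpha_1,\dots,\alpha_n\in\mathbb{F}_q$ be distinct, and let $k,r$ be integers with $1\le r\le k-1$ and $k<n$. Let $C_1$ be the code generated by $G_1$. Then $C_1$ is MDS if and only if both of the following hold: (i) for every $k$-element subset $\{i_1,\dots,i_k\}\subseteq\{1,\dots,n\}$, $$\sum_{1\le j_1<\dots<j_r\le k}\alpha_{i_{j_1}}\alpha_{i_{j_2}}\cdots\alpha_{i_{j_r}}\ne0;$$ (ii) for every $(k-1)$-element subset $\{i_1,\dots,i_{k-1}\}\subseteq\{1,\dots,n\}$, $$\sum_{1\le j_1<\dots<j_{r-1}\le k-1}\alpha_{i_{j_1}}\alpha_{i_{j_2}}\cdots\alpha_{i_{j_{r-1}}}\ne0$$ (for $r=1$ the left-hand side is by convention $1$, so (ii) holds trivially).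
   Context: For distinct $\alpha_1,\dots,\alpha_n\in\mathbb{F}_q$ and $1\le r\le k-1$, $G_{r,k}$ is the $k\times n$ matrix whose rows are $(\alpha_1^e,\alpha_2^e,\dots,\alpha_n^e)$ for $e=0,1,\dots,k-r-1,k-r+1,\dots,k$ in this order (all exponents from $0$ to $k$ except $k-r$; convention $0^0=1$). $G_1$ is the $k\times(n+1)$ matrix obtained by appending to $G_{r,k}$ the column $(0,0,\dots,0,1)^T$, and $C_1$ is the linear code over $\mathbb{F}_q$ generated by $G_1$. An $[N,k]$ linear code is MDS if its minimum distance equals $N-k+1$. *)

(* Defs.v *)
From mathcomp Require Import all_boot all_order all_algebra.

Set Implicit Arguments.
Unset Strict Implicit.
Unset Printing Implicit Defensive.

Import GRing.Theory.
Local Open Scope ring_scope.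

Definition hamming_dist (F : finFieldType) (N : nat) (x y : 'rV[F]_N) : nat :=
  #|[set i : 'I_N | x 0 i != y 0 i]|.

(* Relational, so that the zero code has no minimum distance. *)
Definition is_min_dist (F : finFieldType) (N : nat) (C : {vspace 'rV[F]_N})
    (d : nat) : Prop :=
  (exists x y : 'rV[F]_N,
      [/\ x \in C, y \in C, x != y & hamming_dist x y = d]) /\
  (forall x y : 'rV[F]_N,
      x \in C -> y \in C -> x != y -> (d <= hamming_dist x y)%N).

(* The truncated subtraction is exact since \dim C <= N. *)
Definition MDS (F : finFieldType) (N : nat) (C : {vspace 'rV[F]_N}) : Prop :=
  is_min_dist C (N - \dim C + 1)%N.

Definition generated_code (F : finFieldType) (m N : nat) (G : 'M[F]_(m, N)) :
    {vspace 'rV[F]_N} :=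
  <<[seq row i G | i : 'I_m]>>%VS.

(* [bump (k - r)] enumerates in increasing order the naturals other than
   [k - r], so rows 0, ..., k - 1 carry the exponents 0, ..., k without k - r. *)
Definition Grk (F : finFieldType) (n r k : nat) (alpha : 'I_n -> F) :
    'M[F]_(k, n) :=
  \matrix_(i < k, j < n) alpha j ^+ bump (k - r) i.

Definition G1 (F : finFieldType) (n r k : nat) (alpha : 'I_n -> F) :
    'M[F]_(k, n + 1) :=
  row_mx (Grk r k alpha) (\col_(i < k) (i.+1 == k)%:R).

Definition C1 (F : finFieldType) (n r k : nat) (alpha : 'I_n -> F) :
    {vspace 'rV[F]_(n + 1)} :=
  generated_code (G1 r k alpha).

(* The sum of the products of [s] of the alpha_i with distinct indices i in I;
   for s = 0 only the empty set J contributes and the value is 1. *)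
Definition esym_on (F : finFieldType) (n : nat) (alpha : 'I_n -> F)
    (I : {set 'I_n}) (s : nat) : F :=
  \sum_(J : {set 'I_n} | (J \subset I) && (#|J| == s)) \prod_(j in J) alpha j.

(* Main.v *)
Require Import Defs.
From mathcomp Require Import all_boot all_order all_algebra.
From mathcomp Require Import zify.

Set Implicit Arguments.
Unset Strict Implicit.
Unset Printing Implicit Defensive.

Import GRing.Theory.
Local Open Scope ring_scope.

(** A word of [C1] is the list of values at the [alpha j] of a polynomial [f] of
    degree at most [k] with no term in [X^(k-r)], followed by its coefficient of
    [X^k]. So [C1] is MDS iff no such nonzero [f] has [k] zero coordinates. If the
    last coordinate is nonzero, [f] is a multiple of the product of the
    [X - alpha j] over a [k]-set, whose coefficient of [X^(k-r)] is
    [(-1)^r e_r]; if it is zero, [f] is a multiple of such a product over a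
    [(k-1)]-set, with coefficient [(-1)^(r-1) e_(r-1)]. *)

Lemma subset_of_card (T : finType) (A : {set T}) (m : nat) :
  (m <= #|A|)%N -> exists2 B : {set T}, B \subset A & #|B| = m.
Proof.
move=> lemA.
have : (0 < #|[set B : {set T} | B \subset A & #|B| == m]|)%N.
  by rewrite cards_draws bin_gt0.
by case/card_gt0P => B; rewrite inE => /andP[sBA /eqP cB]; exists B.
Qed.

(** * Products of linear factors over index sets *)

Section Roots.

Variables (F : finFieldType) (n : nat) (alpha : 'I_n -> F).
Hypothesis alpha_inj : injective alpha.

Definition node_poly (I : {set 'I_n}) : {poly F} :=
  \prod_(i in I) ('X - (alpha i)%:P).

Lemma node_polyE (I : {set 'I_n}) :
  node_poly I = \prod_(z <- [seq alpha i | i <- enum I]) ('X - z%:P).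
Proof. by rewrite /node_poly big_map big_enum. Qed.

Lemma size_node_poly (I : {set 'I_n}) : size (node_poly I) = #|I|.+1.
Proof. by rewrite node_polyE size_prod_XsubC size_map cardE. Qed.

Lemma monic_node_poly (I : {set 'I_n}) : node_poly I \is monic.
Proof. exact: monic_prod_XsubC. Qed.

Lemma root_node_poly (I : {set 'I_n}) (i : 'I_n) :
  i \in I -> root (node_poly I) (alpha i).
Proof.
by move=> iI; rewrite node_polyE root_prod_XsubC map_f // mem_enum.
Qed.

(** Vieta's formula: expand by distributivity, [J] being the set of factors that supply their
    constant term. *)
Lemma coef_node_poly (I : {set 'I_n}) (s : nat) : (s <= #|I|)%N ->
  (node_poly I)`_(#|I| - s) = (-1) ^+ s * esym_on alpha I s.
Proof.
move=> les; rewrite /node_poly big_mkcond /=.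
(* Outside [I] the factor 1 is written as 0 + 1: the product then runs over all indices, and every
   [J] not inside [I] contributes 0. *)
pose a i : {poly F} := if i \in I then - (alpha i)%:P else 0.
pose b i : {poly F} := if i \in I then 'X else 1.
rewrite (eq_bigr (fun i => a i + b i)); last first.
  by move=> i _; rewrite /a /b; case: ifP => _; rewrite ?add0r // addrC.
rewrite bigA_distr coef_sum /esym_on mulr_sumr.
rewrite [LHS](bigID (fun J : {set 'I_n} => J \subset I)) /=.
rewrite [X in _ + X]big1 ?addr0; last first.
  move=> J /subsetPn[j jJ jI].
  by rewrite (bigD1 j) //= jJ /a (negPf jI) mul0r coef0.
rewrite [RHS]big_mkcondr; apply: eq_bigr => J sJI.
rewrite (bigID (mem J)) /=.
rewrite (eq_bigr (fun i => (- alpha i)%:P)); last first.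
  by move=> i iJ; rewrite iJ /a (subsetP sJI) // polyCN.
rewrite [X in _ * X](eq_bigr b); last by move=> i /negPf->.
rewrite -rmorph_prod coefCM.
rewrite /b -big_mkcondr /= prodr_const coefXn.
have -> : #|[pred i | i \notin J & i \in I]| = (#|I| - #|J|)%N.
  have -> : #|[pred i | i \notin J & i \in I]| = #|I :\: J|.
    by apply: eq_card => i; rewrite !inE.
  by rewrite cardsD (setIidPr sJI).
have leJ := subset_leq_card sJI.
rewrite eqn_sub2lE // eq_sym.
by case: eqP => [<-|_]; rewrite ?mulr0 // mulr1 prodrN.
Qed.

(** The coefficients of degree [#|I|] cancel in the difference of the two sides, which thus has
    degree below [#|I|] but vanishes at [#|I|] distinct points. *)
Lemma node_poly_scale (I : {set 'I_n}) (f : {poly F}) :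
  (size f <= #|I|.+1)%N -> (forall i, i \in I -> root f (alpha i)) ->
  f = f`_(#|I|) *: node_poly I.
Proof.
move=> szf rootf; apply/eqP; rewrite -subr_eq0; apply/eqP.
apply: (roots_geq_poly_eq0 (rs := [seq alpha i | i <- enum I])).
- apply/allP=> z /mapP[i]; rewrite mem_enum => iI ->.
  by rewrite rootE !hornerE (rootP (rootf i iI)) (rootP (root_node_poly iI))
             mulr0 subr0.
- by rewrite map_inj_uniq ?enum_uniq.
- rewrite size_map -cardE; apply/leq_sizeP => j.
  rewrite leq_eqVlt => /orP[/eqP<-|ltj]; rewrite coefB coefZ.
    have := monicP (monic_node_poly I).
    by rewrite lead_coefE size_node_poly => ->; rewrite mulr1 subrr.
  have /(nth_default 0)-> : (size (node_poly I) <= j)%N.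
    by rewrite size_node_poly.
  by rewrite mulr0 subr0 nth_default // (leq_trans szf).
Qed.

End Roots.

(** * The code as an image of polynomials, and its dimension *)

Section Code.

Variables (F : finFieldType) (n k r : nat) (alpha : 'I_n -> F).
Hypothesis alpha_inj : injective alpha.
Hypotheses (r_ge1 : (1 <= r)%N) (r_le : (r <= k - 1)%N) (k_lt_n : (k < n)%N).

Definition codeword (f : {poly F}) : 'rV[F]_(n + 1) :=
  row_mx (\row_j f.[alpha j]) (const_mx f`_k).

Definition admissible (f : {poly F}) : Prop :=
  (size f <= k.+1)%N /\ f`_(k - r) = 0.

Lemma codeword_sum (c : 'I_k -> F) (g : 'I_k -> {poly F}) :
  codeword (\sum_i c i *: g i) = \sum_i c i *: codeword (g i).
Proof.
apply/rowP=> j; rewrite summxE; case: (split_ordP j) => l ->.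
  rewrite row_mxEl mxE horner_sum; apply: eq_bigr => i _.
  by rewrite mxE row_mxEl mxE hornerZ.
rewrite row_mxEr mxE coef_sum; apply: eq_bigr => i _.
by rewrite mxE row_mxEr mxE coefZ.
Qed.

Lemma codewordB (f g : {poly F}) :
  codeword (f - g) = codeword f - codeword g.
Proof.
apply/rowP=> j; rewrite [RHS]mxE [X in _ = _ + X]mxE.
case: (split_ordP j) => l ->; first by rewrite !row_mxEl !mxE hornerD hornerN.
by rewrite !row_mxEr !mxE coefB.
Qed.

Lemma admissibleB (f g : {poly F}) :
  admissible f -> admissible g -> admissible (f - g).
Proof.
move=> [sf cf] [sg cg]; split; last by rewrite coefB cf cg subr0.
by rewrite (leq_trans (size_polyD _ _)) // geq_max size_polyN sf.
Qed.

Lemma codeword_eq0 (f : {poly F}) :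
  (size f <= n)%N -> codeword f = 0 -> f = 0.
Proof.
move=> szf cw0.
apply: (roots_geq_poly_eq0 (rs := [seq alpha i | i <- enum 'I_n])).
- apply/allP=> z /mapP[i _ ->]; rewrite rootE.
  by move/rowP/(_ (lshift 1 i)): cw0; rewrite row_mxEl !mxE => ->.
- by rewrite map_inj_uniq ?enum_uniq.
- by rewrite size_map size_enum_ord.
Qed.

Lemma row_G1 (i : 'I_k) : row i (G1 r k alpha) = codeword 'X^(bump (k - r) i).
Proof.
apply/rowP=> j; rewrite mxE; case: (split_ordP j) => l ->.
  by rewrite !row_mxEl !mxE hornerXn.
rewrite !row_mxEr !mxE coefXn /bump; congr (_%:R).
have ltik := ltn_ord i.
(* Exponents are shifted by one from [k - r] on. Below the gap, [i < k - r] excludes both [i.+1 = k]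
   and exponent [k], as [r] is positive. *)
case: (leqP (k - r) i) => [_|lti]; first by rewrite add1n eq_sym.
have -> : (i.+1 == k) = false by lia.
by have -> : (k == 0 + i)%N = false by lia.
Qed.

Definition G1_rows : k.-tuple 'rV[F]_(n + 1) :=
  [tuple row i (G1 r k alpha) | i < k].

Lemma G1_rowsE (i : 'I_k) : G1_rows`_i = codeword 'X^(bump (k - r) i).
Proof. by rewrite -tnth_nth tnth_mktuple row_G1. Qed.

Lemma C1E : C1 r k alpha = <<G1_rows>>%VS.
Proof. by []. Qed.

Lemma bump_lt (i : 'I_k) : (bump (k - r) i < k.+1)%N.
Proof. by have := ltn_ord i; rewrite /bump; lia. Qed.

(** The rows of [G1] are the codewords of the monomials that span the admissible polynomials. *)
Lemma C1P (x : 'rV[F]_(n + 1)) :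
  reflect (exists2 f, admissible f & x = codeword f) (x \in C1 r k alpha).
Proof.
rewrite C1E; apply: (iffP idP) => [/coord_span xE|[f [szf f0] ->]].
  exists (\sum_(i < k) coord G1_rows i x *: 'X^(bump (k - r) i)).
    split.
      apply: (leq_trans (size_sum _ _ _)); apply/bigmax_leqP => i _.
      by rewrite (leq_trans (size_scale_leq _ _)) // size_polyXn bump_lt.
    rewrite coef_sum big1 // => i _.
    by rewrite coefZ coefXn (negPf (neq_bump _ _)) mulr0.
  by rewrite codeword_sum {1}xE; apply: eq_bigr => i _; rewrite G1_rowsE.
have lt0 : (k - r < k.+1)%N by rewrite ltnS leq_subr.
have -> : f = \sum_(i < k) f`_(bump (k - r) i) *: 'X^(bump (k - r) i).
  rewrite -[LHS](coefK f) (poly_def (size f)).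
  (* Pad the expansion of [f] to all exponents up to [k]; removing the index [k - r] then reindexes
     the rest by [bump]. *)
  rewrite (big_ord_widen k.+1 (fun i => f`_i *: 'X^i)) // big_mkcond /=.
  rewrite (eq_bigr (fun i : 'I_k.+1 => f`_i *: 'X^i)); last first.
    by move=> i _; case: ltnP => // /(nth_default 0) ->; rewrite scale0r.
  by rewrite (bigD1_ord (Ordinal lt0)) //= f0 scale0r add0r.
rewrite codeword_sum; apply: memv_suml => i _; apply: memvZ.
by rewrite -G1_rowsE; apply: memv_span; rewrite mem_nth ?size_tuple.
Qed.

(** A relation between the rows yields a polynomial of degree at most [k < n] vanishing at all [n]
    nodes, hence zero; its exponents being distinct, each scalar is one of its coefficients. *)
Lemma dim_C1 : \dim (C1 r k alpha) = k.
Proof.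
rewrite C1E; suff /eqP-> : free G1_rows by rewrite size_tuple.
apply/freeP=> c; rewrite (eq_bigr _ (fun i _ => congr1 _ (G1_rowsE i))).
rewrite -codeword_sum => /codeword_eq0 c0 i.
have {}/c0 c0 : (size (\sum_(i < k) c i *: 'X^(bump (k - r) i))%R <= n)%N.
  apply: (leq_trans (size_sum _ _ _)); apply/bigmax_leqP => j _.
  rewrite (leq_trans (size_scale_leq _ _)) // size_polyXn.
  exact: leq_trans (bump_lt j) _.
have := congr1 (fun p : {poly F} => p`_(bump (k - r) i)) c0.
rewrite coef0 coef_sum (bigD1 i) //= coefZ coefXn eqxx mulr1.
rewrite big1 ?addr0 // => j ji; rewrite coefZ coefXn.
case: eqP => [/(can_inj (bumpK _))/val_inj eij|_]; last by rewrite mulr0.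
by rewrite eij eqxx in ji.
Qed.

(** * Distances and numbers of zeros *)

Definition zeros (f : {poly F}) : {set 'I_n} := [set j | root f (alpha j)].

(** The second summand counts the coordinates where the two words agree. *)
Lemma hamming_dist_codeword (f g : {poly F}) :
  (hamming_dist (codeword f) (codeword g)
     + (#|zeros (f - g)%R| + ((f - g)`_k == 0)%R) = n + 1)%N.
Proof.
rewrite /hamming_dist -sum1dep_card big_split_ord /=.
under eq_bigl => j do rewrite !row_mxEl !mxE.
under [X in (_ + X + _)%N]eq_bigl => j do rewrite !row_mxEr !mxE.
rewrite sum1dep_card big_mkcond big_ord1 /= coefB subr_eq0.
rewrite addnACA; congr addn; last by case: eqP.
have <- : ~: zeros (f - g) = [set j | f.[alpha j] != g.[alpha j]].
  by apply/setP=> j; rewrite !inE rootE hornerD hornerN subr_eq0.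
by rewrite addnC cardsC card_ord.
Qed.

Lemma MDS_few_zeros : MDS (C1 r k alpha) ->
  forall f, admissible f -> f != 0 -> (#|zeros f| + (f`_k == 0)%R < k)%N.
Proof.
case=> _; rewrite dim_C1 => dmin f fad f0.
have ad0 : admissible 0 by rewrite /admissible size_poly0 coef0.
have /(dmin _ _) : codeword f \in C1 r k alpha by apply/C1P; exists f.
have /[swap] /[apply] : codeword 0 \in C1 r k alpha by apply/C1P; exists 0.
have -> : codeword f != codeword 0.
  apply: contra f0; rewrite -subr_eq0 -codewordB subr0 => /eqP/codeword_eq0.
  by move=> ->//; apply: leq_trans fad.1 _.
move=> /(_ isT); have := hamming_dist_codeword f 0; rewrite subr0.
move: (hamming_dist _ _) (#|_| + _)%N => d z dz led.
by lia.
Qed.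

(** The first hypothesis bounds all distances from below; the second supplies a word that attains
    the bound. *)
Lemma few_zeros_MDS :
  (forall f, admissible f -> f != 0 -> (#|zeros f| + (f`_k == 0)%R < k)%N) ->
  (exists f, [/\ admissible f, f != 0 & (k - 1 <= #|zeros f|)%N]) ->
  MDS (C1 r k alpha).
Proof.
move=> few [f [fad f0 zf]]; rewrite /MDS dim_C1.
have low (g h : {poly F}) : admissible g -> admissible h -> g != h ->
    (n + 1 - k + 1 <= hamming_dist (codeword g) (codeword h))%N.
  move=> gad had neq; have := few _ (admissibleB gad had).
  rewrite subr_eq0 => /(_ neq).
  by have := hamming_dist_codeword g h; lia.
split; last first.
  move=> x y /C1P[g gad ->] /C1P[h had ->] neq; apply: low => //.
  by apply: contraNneq neq => ->.
have ad0 : admissible 0 by rewrite /admissible size_poly0 coef0.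
exists (codeword f), (codeword 0); split.
- by apply/C1P; exists f.
- by apply/C1P; exists 0.
- apply: contra f0; rewrite -subr_eq0 -codewordB subr0 => /eqP/codeword_eq0.
  by move=> ->//; apply: leq_trans fad.1 _.
(* With [k - 1] zeros at the nodes, the weight is at most [n + 1 - (k - 1)], which is the lower
   bound itself. *)
have := low _ _ fad ad0 f0.
by have := hamming_dist_codeword f 0; rewrite subr0; lia.
Qed.

(** * Zeros and elementary symmetric functions *)

Lemma sub_zeros_node_poly (I : {set 'I_n}) : I \subset zeros (node_poly alpha I).
Proof. by apply/subsetP=> i iI; rewrite inE root_node_poly. Qed.

Lemma coef_node_poly_card (I : {set 'I_n}) : #|I| = k ->
  ((node_poly alpha I)`_(k - r) == 0) = (esym_on alpha I r == 0).
Proof.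
by move=> cI; rewrite -{1}cI coef_node_poly ?cI ?mulf_eq0 ?signr_eq0 //; lia.
Qed.

Lemma coef_node_poly_card1 (I : {set 'I_n}) : #|I| = (k - 1)%N ->
  ((node_poly alpha I)`_(k - r) == 0) = (esym_on alpha I (r - 1) == 0).
Proof.
move=> cI; have -> : (k - r = #|I| - (r - 1))%N by lia.
by rewrite coef_node_poly ?cI ?mulf_eq0 ?signr_eq0 //; lia.
Qed.

(** If a symmetric function vanished, the node polynomial of [I] would itself be admissible with [k]
    zero coordinates. *)
Lemma few_zeros_esym :
  (forall f, admissible f -> f != 0 -> (#|zeros f| + (f`_k == 0)%R < k)%N) ->
  (forall I : {set 'I_n}, #|I| = k -> esym_on alpha I r != 0) /\
  (forall I : {set 'I_n}, #|I| = (k - 1)%N -> esym_on alpha I (r - 1) != 0).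
Proof.
move=> few; split=> I cI.
  rewrite -coef_node_poly_card //; apply/negP=> /eqP c0.
  have := few (node_poly alpha I); rewrite monic_neq0 ?monic_node_poly //.
  have := subset_leq_card (sub_zeros_node_poly I); rewrite cI => lek.
  by move=> /(_ (conj _ c0) isT); rewrite size_node_poly cI leqnn; lia.
rewrite -coef_node_poly_card1 //; apply/negP=> /eqP c0.
have := few (node_poly alpha I); rewrite monic_neq0 ?monic_node_poly //.
have := subset_leq_card (sub_zeros_node_poly I); rewrite cI => lek.
have sz : size (node_poly alpha I) = k by rewrite size_node_poly cI; lia.
(* The degree is [k - 1], so the last coordinate is 0 and provides the [k]-th zero. *)
rewrite nth_default ?sz // eqxx.
by move=> /(_ (conj _ c0) isT); rewrite sz leqnSn; lia.
Qed.

Lemma esym_few_zeros :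
  (forall I : {set 'I_n}, #|I| = k -> esym_on alpha I r != 0) ->
  (forall I : {set 'I_n}, #|I| = (k - 1)%N -> esym_on alpha I (r - 1) != 0) ->
  forall f, admissible f -> f != 0 -> (#|zeros f| + (f`_k == 0)%R < k)%N.
Proof.
move=> h1 h2 f [szf cf] f0; rewrite ltnNge; apply: contra f0 => manyz.
(* Here [f] is a multiple of a polynomial with a nonzero term in [X^(k-r)]; as [f] lacks that term,
   the scalar is 0. *)
have kill (I : {set 'I_n}) : I \subset zeros f -> (size f <= #|I|.+1)%N ->
    (node_poly alpha I)`_(k - r) != 0 -> f = 0.
  move=> sI sz nz.
  have fE : f = f`_(#|I|) *: node_poly alpha I.
    apply: node_poly_scale => // i iI.
    by have := subsetP sI _ iI; rewrite inE.
  have /eqP : f`_(k - r) = 0 by [].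
  rewrite fE coefZ mulf_eq0 (negPf nz) orbF => /eqP->.
  by rewrite scale0r.
(* If the last coordinate is 0, it uses up one of the [k] zeros, but the degree of [f] drops below
   [k] as well, so [k - 1] nodes suffice. *)
apply/eqP; case: eqP manyz => [fk|fk] manyz.
  have [|I sI cI] := @subset_of_card _ (zeros f) (k - 1); first by lia.
  apply: (kill I) => //; last by rewrite coef_node_poly_card1 // h2.
  rewrite cI; have -> : (k - 1).+1 = k by lia.
  apply/leq_sizeP => j; rewrite leq_eqVlt => /orP[/eqP<- //|ltj].
  by rewrite nth_default // (leq_trans szf).
have [|I sI cI] := @subset_of_card _ (zeros f) k; first by lia.
by apply: (kill I) => //; rewrite ?cI // coef_node_poly_card // h1.
Qed.

(* Multiplying the product over a [(k-1)]-set by [X - a] leaves [a] free to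
   cancel the coefficient of [X^(k-r)]. *)
Lemma exists_admissible_zeros :
  (forall I : {set 'I_n}, #|I| = (k - 1)%N -> esym_on alpha I (r - 1) != 0) ->
  exists f, [/\ admissible f, f != 0 & (k - 1 <= #|zeros f|)%N].
Proof.
move=> h2.
have [|I _ cI] := @subset_of_card _ [set: 'I_n] (k - 1).
  by rewrite cardsT card_ord; lia.
have := h2 I cI; rewrite -coef_node_poly_card1 // => pnz.
pose p := node_poly alpha I.
pose a := p`_(k - r).-1 / p`_(k - r).
have p0 : p != 0 by rewrite monic_neq0 ?monic_node_poly.
have XM f : ('X - a%:P) * f = 'X * f - a *: f :> {poly F}.
  by rewrite mulrBl mul_polyC.
exists (('X - a%:P) * p); split.
- split.
    rewrite size_monicM ?monicXsubC // size_XsubC size_node_poly cI.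
    by lia.
  rewrite XM coefB coefXM coefZ mulfVK // ifN ?subrr //.
  by lia.
- by rewrite mulf_neq0 // polyXsubC_eq0.
rewrite -cI; apply/subset_leq_card/subsetP=> i iI.
by rewrite inE rootM (root_node_poly alpha iI) orbT.
Qed.

End Code.

Theorem theorem4p5 (F : finFieldType) (n k r : nat) (alpha : 'I_n -> F)
    (alpha_inj : injective alpha)
    (r_ge1 : (1 <= r)%N) (r_le : (r <= k - 1)%N) (k_lt_n : (k < n)%N) :
  MDS (C1 r k alpha) <->
  (forall I : {set 'I_n}, #|I| = k -> esym_on alpha I r != 0) /\
  (forall I : {set 'I_n}, #|I| = (k - 1)%N -> esym_on alpha I (r - 1) != 0).
Proof.
split=> [mds|[h1 h2]].
  by apply: few_zeros_esym => //; apply: MDS_few_zeros.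
(* Condition (ii) serves twice: with (i) to bound the number of zeros, and alone to produce a word
   of minimum weight. *)
apply: (few_zeros_MDS alpha_inj r_ge1 r_le k_lt_n).
  exact: esym_few_zeros.
exact: exists_admissible_zeros.
Qed.
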